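(* Consider the Diophantine equation $$F_{n_1}F_{n_2}F_{n_3}\cdots F_{n_k}+1 = F_m^2$$ in integers $m\geq 0$, $k\geq 1$, and $0\leq n_1\leq n_2 \leq \cdots \leq n_k$. It has a solution for every $m\geq 1$. Moreover, the nontrivial solutions are exactly those given by \begin{align*} &F_0+1 = F_1^2,\quad F_0+1 = F_2^2,\quad F_4+1 = F_3^2,\quad F_3^3+1 = F_6+1 = F_4^2, \\ &F_3^3F_4+1 = F_5^2,\quad F_3^3F_8+1 = F_7^2,\quad F_3^3F_{10}+1 = F_8^2,\quad AF_8+1 = F_{10}^2,\\ &AF_{10}+1 = F_{11}^2, \quad AF_{14}+1 = F_{13}^2,\quad AF_{16}+1 = F_{14}^2, \end{align*} where $A$ stands for either of the two (numerically equal) products $A = F_3F_4^2F_6 = F_3^4F_4^2$, together with the infinite family $$F_{m-\varepsilon}F_{m+\varepsilon} + 1 = F_m^2\quad\text{for all } m\geq 5,$$ where $\varepsilon=\varepsilon(m)=1$ if $m$ is odd and $\varepsilon=\varepsilon(m)=2$ if $m$ is even.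
   Context: $(F_n)_{n\ge 0}$ is the Fibonacci sequence: $F_0=0$, $F_1=1$, $F_n=F_{n-1}+F_{n-2}$ for $n\ge 2$. A solution is a tuple $(m,k,n_1,\dots,n_k)$; the indices $n_i$ need not be distinct, and in a displayed solution a power $F_n^a$ on the left-hand side means that the index $n$ occurs $a$ times among $n_1,\dots,n_k$ (so each displayed product, with factors sorted by index, specifies a tuple). A solution is called nontrivial if either $k=1$, or $k\geq 2$ and $n_1\geq 3$. *)

(* Defs.v *)
(* MathComp world. *)
From mathcomp Require Import all_boot.

Set Implicit Arguments.
Unset Strict Implicit.
Unset Printing Implicit Defensive.

Fixpoint fib (n : nat) : nat :=
  match n with
  | 0 => 0
  | 1 => 1
  | (n''.+1 as n').+1 => fib n' + fib n''
  end.

(* The tuple n holds the indices n_1, ..., n_k. *)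
Definition is_solution (m k : nat) (n : k.-tuple nat) : Prop :=
  [/\ 1 <= k, sorted leq n & \prod_(i <- n) fib i + 1 = fib m ^ 2].

(* Since k >= 2 in the second case, [head 0 n] is n_1, not the default. *)
Definition nontrivial (k : nat) (n : k.-tuple nat) : Prop :=
  k = 1 \/ 2 <= k /\ 3 <= head 0 n.

(* The index sequences of F_3 F_4^2 F_6 and F_3^4 F_4^2, both equal to 144. *)
Definition A_indices : seq (seq nat) :=
  [:: [:: 3; 4; 4; 6]; [:: 3; 3; 3; 3; 4; 4]].

(* A pair (m, [:: n_1; ...; n_k]) stands for F_{n_1} ... F_{n_k} + 1 = F_m^2. *)
Definition sporadic_solutions : seq (nat * seq nat) :=
  [:: (1, [:: 0]); (2, [:: 0]); (3, [:: 4]);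
      (4, [:: 3; 3; 3]); (4, [:: 6]);
      (5, [:: 3; 3; 3; 4]); (7, [:: 3; 3; 3; 8]); (8, [:: 3; 3; 3; 10])]
  ++ [seq (10, rcons A 8) | A <- A_indices]
  ++ [seq (11, rcons A 10) | A <- A_indices]
  ++ [seq (13, rcons A 14) | A <- A_indices]
  ++ [seq (14, rcons A 16) | A <- A_indices].

Definition eps (m : nat) : nat := if odd m then 1 else 2.

(* Main.v *)
Require Import Defs.
From mathcomp Require Import all_boot all_order all_algebra zify ring lra.
From mathcomp Require Import realalg.

Set Implicit Arguments.
Unset Strict Implicit.
Unset Printing Implicit Defensive.

(* For m >= 1, F_m^2 - 1 = F_a F_b with a = m - eps m and b = m + eps m, both even. A prime dividing F_b
   but no earlier Fibonacci number must divide some F_{n_i}, and size forces n_i = b; after cancelling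
   F_b the same argument gives n_j = a. Every even index n >= 4 other than 6 and 12 has such a primitive
   prime, so only the m with 6 or 12 in {a, b} remain, where one factors F_6 = 8 and F_12 = 144 instead.

   Existence of primitive primes (Carmichael): let Q be the product of F_{n/e}^{mu(e)} over the squarefree
   divisors e of n. If n has no primitive prime, lifting the exponent shows that v_p(Q) <= 1 for p | n and
   v_p(Q) <= 0 otherwise, so Q <= rad n. Comparing each factor with a power of the golden ratio gives
   Q >= F_{X+1} with X = totient n - 2^(r-1), r being the number of primes of n, which exceeds rad n for
   all even n outside a short list, on which a primitive prime is exhibited. *)

(** * Growth, addition formula and divisibility of Fibonacci numbers *)

Lemma fibSS n : fib n.+2 = fib n.+1 + fib n.
Proof. by []. Qed.

Lemma fib_gt0 n : 0 < n -> 0 < fib n.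
Proof.
have H : forall k, (0 < fib k.+1) && (0 < fib k.+2).
  by elim=> // k /andP[h1 h2]; rewrite h2 fibSS addn_gt0 h2.
by case: n => // n _; case/andP: (H n).
Qed.

Lemma fib_leS n : fib n <= fib n.+1.
Proof. by case: n => // n; rewrite fibSS leq_addr. Qed.

Lemma leq_fib m n : m <= n -> fib m <= fib n.
Proof. exact: (homo_leq (r := leq) leqnn leq_trans fib_leS). Qed.

Lemma fib_ge2 n : 3 <= n -> 2 <= fib n.
Proof. exact: leq_fib. Qed.

Lemma fibD m n : fib (m + n.+1) = fib m.+1 * fib n.+1 + fib m * fib n.
Proof.
elim: m n => [|m IH] n; first by rewrite add0n mul1n mul0n addn0.
rewrite addSnnS IH !fibSS; ring.
Qed.

Lemma coprime_fibS n : coprime (fib n) (fib n.+1).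
Proof.
elim: n => // n IH.
by rewrite fibSS /coprime addnC gcdnDr gcdnC.
Qed.

Lemma dvdn_fib k n : k %| n -> fib k %| fib n.
Proof.
case/dvdnP=> j ->; case: k => [|k]; first by rewrite muln0.
elim: j => // j IH; rewrite mulSn addnC fibD.
by apply: dvdn_add; [exact: dvdn_mull | exact: dvdn_mulr].
Qed.

Lemma leq_fibM a b : fib a.+1 * fib b.+1 <= fib (a + b).+1.
Proof. by rewrite -addnS fibD leq_addr. Qed.

Lemma leq_fibX a j : fib a.+1 ^ j <= fib (j * a).+1.
Proof.
elim: j => // j IH; rewrite expnS mulSn.
exact: leq_trans (leq_mul (leqnn _) IH) (leq_fibM _ _).
Qed.

(** * Lifting the exponent and the rank of apparition *)

(* Expansion of (w + u x)^(j+2) modulo u^3 with x^2 = x + 1, where u = fib k.+1, w = fib k and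
   w + u x is the (k+1)-st power of the golden ratio x. *)
Lemma fib_mul_expand k j : exists x y,
  fib (j.+2 * k.+1) = j.+2 * fib k ^ j.+1 * fib k.+1
     + 'C(j.+2, 2) * fib k ^ j * fib k.+1 ^ 2 + x * fib k.+1 ^ 3 /\
  fib (j.+2 * k.+1).-1 = fib k ^ j.+2
     + 'C(j.+2, 2) * fib k ^ j * fib k.+1 ^ 2 + y * fib k.+1 ^ 3.
Proof.
set u := fib k.+1; set w := fib k.
have step i : fib (i.+2 * k.+1) =
      (fib (i.+1 * k.+1) + fib (i.+1 * k.+1).-1) * u + fib (i.+1 * k.+1) * w /\
    fib (i.+2 * k.+1).-1 = fib (i.+1 * k.+1) * u + fib (i.+1 * k.+1).-1 * w.
  set n := (i.+1 * k.+1).-1.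
  have en : i.+1 * k.+1 = n.+1 by [].
  have -> : i.+2 * k.+1 = (n + k.+1).+1 by rewrite mulSn en; lia.
  split; first by rewrite en -addSn fibD.
  by rewrite en [_.-1]/= fibD.
elim: j => [|j [x [y [IH1 IH2]]]].
  exists 0, 0; have [-> ->] := step 0.
  rewrite mul1n [k.+1.-1]/= binn; split; rewrite -/u -/w; ring.
have [-> ->] := step j.+1; rewrite IH1 IH2.
rewrite [in 'C(j.+3, 2)]binS bin1; set c := 'C(j.+2, 2).
exists (c * w ^ j + x * u + x * w + c * w ^ j + y * u),
   (c * w ^ j + x * u + y * w).
by split; rewrite !expnS; ring.
Qed.

(** By the expansion [fib (q * k)] is [fib k] times a cofactor congruent to q w^(q-1) modulo
    [fib k], where w is the preceding Fibonacci number. As w is coprime to [fib k], [p] does not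
    divide the cofactor. *)
Lemma logn_fib_mul p q k : prime p -> prime q -> q != p -> 0 < k ->
  p %| fib k -> logn p (fib (q * k)) = logn p (fib k).
Proof.
move=> pp pq qp; case: k => // k _ pk.
case: q pq qp => [|[|j]] // pq qp.
have [x [_ [-> _]]] := fib_mul_expand k j.
set u := fib k.+1; set w := fib k.
have u0 : 0 < u by apply: fib_gt0.
set c := j.+2 * w ^ j.+1 + u * ('C(j.+2, 2) * w ^ j + x * u).
have -> : j.+2 * w ^ j.+1 * u + 'C(j.+2, 2) * w ^ j * u ^ 2 + x * u ^ 3 = u * c.
  by rewrite /c; ring.
have pw : ~~ (p %| w).
  rewrite -prime_coprime // coprime_sym.
  exact: coprime_dvdr pk (coprime_fibS k).
have pc : ~~ (p %| c).
  rewrite /c dvdn_addl; last exact: dvdn_mulr.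
  rewrite Euclid_dvdM // negb_or (dvdn_prime2 pp pq) eq_sym qp /=.
  by rewrite Euclid_dvdX // negb_and pw.
have c0 : 0 < c by case: (posnP c) pc => [->|//]; rewrite dvdn0.
by rewrite lognM // (lognE p c) (negbTE pc) !andbF addn0.
Qed.

(** Here the cofactor of [fib k] is p c with c congruent to w^(p-1) modulo p. The quadratic term
    carries 'C(p, 2), which p divides only when p is odd; for p = 2 the spare factor 2 must come
    from [fib k], hence the condition on 4. *)
Lemma logn_fib_mulp p k : prime p -> 0 < k -> p %| fib k ->
  (p = 2 -> 4 %| fib k) -> logn p (fib (p * k)) = (logn p (fib k)).+1.
Proof.
move=> pp; case: k => // k _ pk p2.
have := pp; case: p pp pk p2 => [|[|j]] // pp pk p2 _; set p := j.+2 in pp pk p2 *.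
have [x [_ [-> _]]] := fib_mul_expand k j.
rewrite -/p; set u := fib k.+1 in pk p2 *; set w := fib k.
have u0 : 0 < u by apply: fib_gt0.
have [u' eu] := dvdnP pk.
set r := 'C(p, 2) * w ^ j * u' + x * (p * u' ^ 2).
set c := w ^ j.+1 + r.
have -> : p * w ^ j.+1 * u + 'C(p, 2) * w ^ j * u ^ 2 + x * u ^ 3 = u * (p * c).
  rewrite /c /r !expnS !expn0 {1 2 4}eu; rewrite eu; ring.
have pw : ~~ (p %| w).
  rewrite -prime_coprime // coprime_sym.
  exact: coprime_dvdr pk (coprime_fibS k).
have pr : p %| r.
  rewrite /r dvdn_addl; last by rewrite dvdn_mull // dvdn_mulr.
  have [e2|ne2] := eqVneq p 2.
    by move: (p2 e2); rewrite eu e2 -[4]/(2 * 2) dvdn_pmul2r // => h; rewrite dvdn_mull.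
  rewrite -mulnA dvdn_mulr // prime_dvd_bin //=.
  by rewrite ltn_neqAle eq_sym ne2 prime_gt1.
have pc : ~~ (p %| c) by rewrite /c dvdn_addl // Euclid_dvdX // negb_and pw.
have c0 : 0 < c by case: (posnP c) pc => [->|//]; rewrite dvdn0.
rewrite !lognM ?muln_gt0 ?c0 ?u0 ?(prime_gt0 pp) //.
have -> : logn p c = 0 by rewrite lognE (negbTE pc) !andbF.
by rewrite (pfactorK 1 pp) addnA addn0 addn1.
Qed.

(** Take z minimal with p dividing [fib z] and divide k by z with remainder r. The addition formula
    and the coprimality of consecutive Fibonacci numbers pass divisibility from [fib k] to [fib r],
    so minimality forces r = 0. *)
Lemma fib_rank p n : prime p -> 0 < n -> p %| fib n ->
  exists2 z, 0 < z & forall k, (p %| fib k) = (z %| k).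
Proof.
move=> pp n0 pn.
have ex : exists z, (0 < z) && (p %| fib z) by exists n; rewrite n0.
case: (ex_minnP ex) => z /andP[z0 pz] zmin.
exists z => // k; apply/idP/idP; last by move=> zk; exact: dvdn_trans pz (dvdn_fib zk).
move=> pk; rewrite /dvdn; have zr := ltn_pmod k z0.
case er: (k %% z) => [//|r].
have: p %| fib r.+1.
  move: pk; rewrite {1}(divn_eq k z) er fibD dvdn_addl.
    rewrite Euclid_dvdM // => /orP[pS|//].
    have pzk : p %| fib (k %/ z * z) by apply: dvdn_trans pz (dvdn_fib (dvdn_mull _ _)).
    move: (coprime_fibS (k %/ z * z)) => cop.
    have : p %| gcdn (fib (k %/ z * z)) (fib (k %/ z * z).+1) by rewrite dvdn_gcd pzk.
    by rewrite (eqP cop) dvdn1 => /eqP p1; move: pp; rewrite p1.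
  by rewrite dvdn_mulr //; apply: dvdn_trans pz (dvdn_fib (dvdn_mull _ _)).
move=> pr; have := zmin r.+1; rewrite pr /= => /(_ isT).
by rewrite -er leqNgt zr.
Qed.

(** * Alternating sums over squarefree divisors and p-adic valuations *)

(* With n = m * \prod_(q <- s) q, this is the sum of mu(e) * f (n / e) over e dividing the product of s. *)
Fixpoint fdiff (f : nat -> int) (s : seq nat) (m : nat) : int :=
  if s is q :: s' then (fdiff f s' (q * m) - fdiff f s' m)%R else f m.

Lemma eq_fdiff f g s m : (forall c, c %| \prod_(q <- s) q -> f (c * m) = g (c * m)) ->
  fdiff f s m = fdiff g s m.
Proof.
elim: s m => [|q s IH] m /= fg; first by rewrite -[m]mul1n fg ?dvd1n.
rewrite (IH (q * m)) ?(IH m) // => c cs.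
  by apply: fg; rewrite big_cons dvdn_mull.
by rewrite mulnCA mulnA fg // big_cons dvdn_mul.
Qed.

(** The difference operators commute, so the first may be applied to [f] itself. Together with
    [fdiff_rem] this singles out any chosen prime of [s]. *)
Lemma fdiff_cons f q s m :
  fdiff f (q :: s) m = fdiff (fun k => f (q * k) - f k)%R s m.
Proof.
elim: s m => [|r s IH] m //=.
rewrite -!IH /= mulnCA; ring.
Qed.

Lemma fdiff_rem f q s m : q \in s -> fdiff f s m = fdiff f (q :: rem q s) m.
Proof.
elim: s m => [|r s IH] m //; rewrite inE eq_sym /=.
have [-> //|nrq /= qs] := eqVneq r q.
by rewrite !IH //= (mulnCA q); ring.
Qed.

Lemma fdiff_eq0 f s m : (forall c, c %| \prod_(q <- s) q -> f (c * m) = 0%R) ->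
  fdiff f s m = 0%R.
Proof.
move=> f0; rewrite (@eq_fdiff f (fun=> 0%R)) //.
by elim: s m {f0} => [|q s IH] m //=; rewrite !IH GRing.subr0.
Qed.

Lemma fdiff_top f s m : all prime s ->
  (forall c, c %| \prod_(q <- s) q -> c != \prod_(q <- s) q -> f (c * m) = 0%R) ->
  fdiff f s m = f (\prod_(q <- s) q * m).
Proof.
elim: s m => [|q s IH] m /=; first by rewrite big_nil mul1n.
case/andP=> pq ps; rewrite big_cons => f0.
have s0 : 0 < \prod_(r <- s) r.
  by rewrite big_seq prodn_cond_gt0 // => r rs; apply/prime_gt0/(allP ps).
rewrite IH //; last first.
  move=> c cs ncs; rewrite mulnCA mulnA f0 ?dvdn_mul //.
  by rewrite eqn_pmul2l ?prime_gt0.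
rewrite fdiff_eq0; last first.
  move=> c cs; rewrite f0 ?dvdn_mull //.
  have := dvdn_leq s0 cs; have := prime_gt1 pq; nia.
by rewrite GRing.subr0 mulnCA mulnA.
Qed.

(** This is the bound v_p(Q) <= [p | n] for an index without primitive prime. With z the rank of p
    and n = t z, the last hypothesis gives t > 1, and the cases depend on whether t has a prime
    factor other than p. The value n = 6 is a true exception: at p = 2 the sum is 3 - 1 = 2. *)
Lemma fdiff_logn_fib p n s m : prime p -> 0 < n -> n != 6 ->
  n = \prod_(q <- s) q * m -> uniq s -> s =i primes n ->
  (p %| fib n -> exists2 d, 0 < d < n & p %| fib d) ->
  (fdiff (fun k => (logn p (fib k))%:Z) s m <= (p %| n)%:Z)%R.
Proof.
move=> pp n0 n6 en us sn nprim.
have ps q : q \in s -> prime q by rewrite sn mem_primes => /andP[].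
have m0 : 0 < m by move: n0; rewrite en muln_gt0 => /andP[].
have fk0 k : 0 < k -> ~~ (p %| fib k) -> logn p (fib k) = 0.
  by move=> k0 pk; rewrite lognE (negbTE pk) !andbF.
case pn: (p %| fib n); last first.
  rewrite fdiff_eq0 ?lez_nat // => c cs.
  have cmn : c * m %| n by rewrite en dvdn_pmul2r.
  rewrite fk0 // ?(dvdn_gt0 n0 cmn) //.
  by apply: contraFN pn => h; apply: dvdn_trans h (dvdn_fib cmn).
have [z z0 zP] := fib_rank pp n0 pn.
have [d /andP[d0 dn] pd] := nprim pn.
have [t et] : exists t, n = t * z by apply/dvdnP; rewrite -zP.
have t0 : 0 < t by move: n0; rewrite et muln_gt0 => /andP[].
have t1 : 1 < t.
  have zd : z <= d by apply: dvdn_leq => //; rewrite -zP.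
  have := leq_ltn_trans zd dn; rewrite et; nia.
have split_rem q : q \in s -> \prod_(r <- s) r = q * \prod_(r <- rem q s) r.
  by move=> qs; rewrite (perm_big _ (perm_to_rem qs)) big_cons.
have cop_rem q : q \in s -> coprime q (\prod_(r <- rem q s) r).
  move=> qs; rewrite big_seq; apply: (big_ind (coprime q)); first exact: coprimen1.
    by move=> x y; rewrite coprimeMr => -> ->.
  move=> r; rewrite (mem_rem_uniq q us) inE => /andP[rq rs].
  by rewrite prime_coprime ?ps // dvdn_prime2 ?ps // eq_sym.
have [/hasP[q qs /andP[qp qt]]|/hasPn tp] := boolP (has (fun q => (q != p) && (q %| t)) s).
  (* q divides n / z and q <> p: removing q changes no valuation. *)
  rewrite (fdiff_rem _ _ qs) fdiff_cons fdiff_eq0 // => c cs.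
  have pq := ps q qs.
  have cm0 : 0 < c * m.
    rewrite muln_gt0 m0 andbT; apply: dvdn_gt0 cs; move: n0.
    by rewrite en (split_rem q qs) !muln_gt0 => /andP[/andP[]].
  have [zk|nzk] := boolP (z %| c * m).
    have pk : p %| fib (c * m) by rewrite zP.
    have -> : logn p (fib (q * (c * m))) = logn p (fib (c * m)) by exact: logn_fib_mul.
    exact: GRing.subrr.
  (* Then z divides neither index, so both valuations vanish. Otherwise z divides both q c m and e c
     m, where n = q e c m and e is coprime to q, hence it divides c m. *)
  suff nzqk : ~~ (z %| q * (c * m)).
    by rewrite /= !fk0 ?zP ?muln_gt0 ?(prime_gt0 pq) // -muln_gt0.
  apply: contra nzk => zqk.
  have copc : coprime q (\prod_(r <- rem q s) r %/ c).
    apply: coprime_dvdr (cop_rem q qs).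
    by case/dvdnP: cs => x ->; rewrite mulnK ?dvdn_mulr //; move: cm0; rewrite muln_gt0 => /andP[].
  set e := _ %/ c in copc.
  have enqc : n = q * (e * (c * m)).
    by rewrite en (split_rem q qs) /e (mulnA _ c) divnK // mulnA.
  have zek : z %| e * (c * m).
    case/dvdnP: qt => t' ett; apply/dvdnP; exists t'.
    apply/eqP; rewrite -(eqn_pmul2l (prime_gt0 pq)) -enqc et ett; apply/eqP; ring.
  have : z %| gcdn (q * (c * m)) (e * (c * m)) by rewrite dvdn_gcd zqk.
  by rewrite -muln_gcdl (eqP copc) mul1n.
(* Otherwise n / z is a power of p and the only contribution is logn p (fib n) - logn p (fib (n / p)). *)
have tP q : prime q -> q %| t -> q = p.
  move=> pq qt; apply/eqP; have := tp q; rewrite sn mem_primes pq n0 et dvdn_mulr //=.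
  by rewrite qt andbT => /(_ isT); rewrite negbK.
have pt : p %| t by rewrite -(tP (pdiv t)) ?pdiv_dvd ?pdiv_prime.
have pn' : p %| n by rewrite et dvdn_mulr.
have pins : p \in s by rewrite sn mem_primes pp n0.
rewrite (fdiff_rem _ _ pins) fdiff_cons pn'.
set P := \prod_(r <- rem p s) r.
have enP : n = p * (P * m) by rewrite en (split_rem p pins) mulnA.
have Pm0 : 0 < P * m by move: n0; rewrite enP muln_gt0 => /andP[].
have zPm : z %| P * m.
  case/dvdnP: pt => t' ett; apply/dvdnP; exists t'.
  apply/eqP; rewrite -(eqn_pmul2l (prime_gt0 pp)) -enP et ett; apply/eqP; ring.
rewrite fdiff_top; last first.
- rewrite -/P => c cP cneP.
  have cm0 : 0 < c * m.
    rewrite muln_gt0 m0 andbT; apply: dvdn_gt0 cP.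
    by move: Pm0; rewrite muln_gt0 => /andP[].
  have [e eP] := dvdnP cP.
  (* Otherwise e = P / c > 1 would divide t, whose only prime factor is p, although P is coprime to
     p. *)
  have nz : ~~ (z %| p * (c * m)).
    apply/negP => /dvdnP[x ex].
    have etx : t = e * x.
      apply/eqP; rewrite -(eqn_pmul2r z0) -et -mulnA -ex enP eP; apply/eqP; ring.
    have e1 : 1 < e.
      case: e eP {etx} => [|[|e]] // eP; last by move: cneP; rewrite eP mul1n eqxx.
      by move: Pm0; rewrite eP.
    have ep : pdiv e = p.
      by apply: tP; rewrite ?pdiv_prime // etx dvdn_mulr // pdiv_dvd.
    have := cop_rem p pins; rewrite -/P prime_coprime // => /negP; apply.
    by rewrite -ep eP dvdn_mulr // pdiv_dvd.
  have nz' : ~~ (z %| c * m) by apply: contra nz => h; rewrite dvdn_mull.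
  by rewrite /= !fk0 ?zP ?muln_gt0 ?(prime_gt0 pp) // -muln_gt0.
- by apply/allP => q; rewrite (mem_rem_uniq p us) inE => /andP[_ /ps].
rewrite -/P /= logn_fib_mulp ?zP //.
  by rewrite -addn1 PoszD; lia.
(* For p = 2 lifting needs 4 to divide [fib (n / 2)]. The rank is 3, t is a power of 2, and n <> 6
   excludes t = 2; so 6 divides n / 2, and F_6 = 8. *)
move=> p2; have z3 : z = 3.
  have : z %| 3 by rewrite -zP p2.
  rewrite dvdn_divisors // !inE => /orP[/eqP z1|/eqP //].
  by have := zP 1; rewrite z1 p2.
have t4 : 4 %| t.
  have [h eh] := dvdnP pt; rewrite eh p2 -[4]/(2 * 2) dvdn_pmul2r //.
  apply: contraT => h2.
  have h1 : 1 < h.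
    by case: h eh h2 => [|[|h]] // eh; move: n6; rewrite et eh p2 z3.
  have := tP (pdiv h) (pdiv_prime h1).
  rewrite eh dvdn_mulr ?pdiv_dvd // p2 => /(_ isT) e2.
  by move: (pdiv_dvd h); rewrite e2 (negbTE h2).
have h6 : 6 %| P * m.
  have e2n : n = 2 * (P * m) by rewrite {1}enP p2.
  rewrite -(@dvdn_pmul2l 2) // -e2n et z3 -[2 * 6]/(4 * 3).
  by rewrite dvdn_pmul2r.
by apply: dvdn_trans (dvdn_fib h6).
Qed.

(* Numerator and denominator of the product of the F_{n/e}^{mu(e)}, without cancellation. *)
Fixpoint fib_quotient (s : seq nat) (m : nat) : nat * nat :=
  if s is q :: s' then
    let x := fib_quotient s' (q * m) in let y := fib_quotient s' m in
    (x.1 * y.2, x.2 * y.1)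
  else (fib m, 1).

Lemma fib_quotient_gt0 s m : all prime s -> 0 < m ->
  (0 < (fib_quotient s m).1) && (0 < (fib_quotient s m).2).
Proof.
elim: s m => [|q s IH] m /=; first by move=> _ /fib_gt0 ->.
case/andP=> pq ps m0; rewrite !muln_gt0.
have qm0 : 0 < q * m by rewrite muln_gt0 prime_gt0.
by have /andP[-> ->] := IH (q * m) ps qm0; have /andP[-> ->] := IH m ps m0.
Qed.

Lemma logn_fib_quotient p s m : all prime s -> 0 < m ->
  ((logn p (fib_quotient s m).1)%:Z - (logn p (fib_quotient s m).2)%:Z =
  fdiff (fun k => (logn p (fib k))%:Z) s m)%R.
Proof.
elim: s m => [|q s IH] m /=; first by rewrite logn1 GRing.subr0.
case/andP=> pq ps m0.
have qm0 : 0 < q * m by rewrite muln_gt0 prime_gt0.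
rewrite -!IH //.
have /andP[? ?] := fib_quotient_gt0 ps qm0; have /andP[? ?] := fib_quotient_gt0 ps m0.
rewrite !lognM // !PoszD; ring.
Qed.

(** * Comparison with powers of the golden ratio *)

Section GoldenRatio.
Import Order.TTheory GRing.Theory Num.Theory.
Local Open Scope ring_scope.

Lemma golden_ratio_exists (R : rcfType) : exists2 a : R, 1 <= a & a ^+ 2 = a + 1.
Proof.
exists ((1 + Num.sqrt 5) / 2).
  have : 1 <= Num.sqrt (5 : R) by rewrite -[leLHS]sqrtr1 ler_sqrt; lra.
  lra.
have : Num.sqrt 5 ^+ 2 = 5 :> R by rewrite sqr_sqrtr; lra.
nra.
Qed.

Lemma golden_pow_fib (R : rcfType) (a : R) n : a ^+ 2 = a + 1 ->
  a ^+ n.+1 = (fib n.+1)%:R * a + (fib n)%:R.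
Proof.
move=> a2; elim: n => [|n IH]; first by rewrite expr1 mul1r addr0.
rewrite exprS IH fibSS natrD mulrDr mulrCA -expr2 a2; ring.
Qed.

(** With [golden_le_fib] this gives a^(n-2) <= F_n <= a^(n-1), stated without division so that small
    [n] needs no special treatment. *)
Lemma fib_le_golden (R : rcfType) (a : R) n : a ^+ 2 = a + 1 ->
  (fib n)%:R * a <= a ^+ n.
Proof.
move=> a2; case: n => [|n]; first by rewrite mul0r expr0.
by rewrite golden_pow_fib // lerDl.
Qed.

Lemma golden_le_fib (R : rcfType) (a : R) n : a ^+ 2 = a + 1 ->
  (0 < n)%N -> a ^+ n <= (fib n)%:R * a ^+ 2.
Proof.
move=> a2; case: n => // n _; rewrite golden_pow_fib // a2 mulrDr mulr1 lerD2l ler_nat.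
exact: fib_leS.
Qed.

(** Each factor F_k lies between a^(k-2) and a^(k-1), and numerator and denominator have 2^(r-1)
    factors each, so the errors add up to at most 2^(r-1) in the exponent; here r - 1 is [size s].
    Both bounds are proved together because the induction divides a lower bound at q m by an upper
    bound at m, and conversely. *)
Lemma fib_quotient_golden (R : rcfType) (a : R) q s m :
  1 <= a -> a ^+ 2 = a + 1 -> all prime (q :: s) -> (0 < m)%N ->
  let x := fib_quotient (q :: s) m in
  let phi := (\prod_(r <- q :: s) r.-1)%N in
  a ^+ (m * phi) * x.2%:R <= x.1%:R * a ^+ (2 ^ size s) /\
  x.1%:R <= x.2%:R * a ^+ (m * phi + 2 ^ size s).
Proof.
move=> a1 a2; have a0 : 0 < a by apply: lt_le_trans a1.
have an0 n : 0 < a ^+ n by rewrite exprn_gt0.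
elim: s q m => [|r s IH] q m.
  rewrite /= andbT big_cons big_nil muln1 mul1n muln1 expn0 expr1 => pq m0.
  have qm0 : (0 < q * m)%N by rewrite muln_gt0 prime_gt0.
  have eqm : (q * m = m * q.-1 + m)%N by have := prime_gt0 pq; nia.
  have Uq := fib_le_golden (q * m) a2; have Lq := golden_le_fib a2 qm0.
  have U := fib_le_golden m a2; have L := golden_le_fib a2 m0.
  move: Uq Lq; rewrite {2 3}eqm exprD; set A := a ^+ (m * q.-1).
  set B := a ^+ m in U L *; set x := (fib _)%:R; set y := (fib _)%:R.
  have A0 : 0 < A by apply: an0.
  move=> Uq Lq; split.
    rewrite -(ler_pM2r a0) -mulrA.
    apply: le_trans (ler_wpM2l (ltW A0) U) _.
    by rewrite -[_ * a * a]mulrA -expr2.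
  rewrite -(ler_pM2r a0); apply: le_trans Uq _.
  rewrite exprD expr1 -/A.
  apply: le_trans (ler_wpM2l (ltW A0) L) _.
  by rewrite le_eqVlt; apply/orP; left; apply/eqP; ring.
move=> /andP[pq prs] m0.
have qm0 : (0 < q * m)%N by rewrite muln_gt0 prime_gt0.
have [] := IH r _ prs qm0; have [] := IH r _ prs m0; cbv zeta.
set phi := (\prod_(i <- r :: s) i.-1)%N; set L := (2 ^ size s)%N.
have -> : (\prod_(i <- q :: r :: s) i.-1 = q.-1 * phi)%N by rewrite big_cons.
have eqm : (q * m * phi = m * (q.-1 * phi) + m * phi)%N.
  by have := prime_gt0 pq; case: q {pq prs qm0} => // q _ /=; ring.
have eL : (2 ^ (size s).+1 = L + L)%N by rewrite expnS /L; lia.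
set x := fib_quotient (r :: s) (q * m); set y := fib_quotient (r :: s) m.
have -> : fib_quotient [:: q, r & s] m = (x.1 * y.2, x.2 * y.1)%N by [].
clearbody x y; rewrite eqm [size (r :: s)]/= eL [(_, _).1]/= [(_, _).2]/= !natrM !exprD.
set A := a ^+ (m * (q.-1 * phi)); set B := a ^+ (m * phi); set C := a ^+ L.
have A0 : 0 < A by apply: an0.
have B0 : 0 < B by apply: an0.
have C0 : 0 < C by apply: an0.
have x1 : 0 <= x.1%:R :> R by [].
have x2 : 0 <= x.2%:R :> R by [].
have y1 : 0 <= y.1%:R :> R by [].
have y2 : 0 <= y.2%:R :> R by [].
move=> ly uy lx ux; split.
  rewrite -(ler_pM2r B0).
  have := ler_pM (mulr_ge0 (mulr_ge0 (ltW A0) (ltW B0)) x2) y1 lx uy; lra.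
rewrite -(ler_pM2r B0).
have := ler_pM x1 (mulr_ge0 (ltW B0) y2) ux ly; lra.
Qed.
End GoldenRatio.

Lemma fib_quotient_lower q s m X : all prime (q :: s) -> 0 < m ->
  m * \prod_(r <- q :: s) r.-1 = X + 2 ^ size s ->
  fib X.+1 * (fib_quotient (q :: s) m).2 <= (fib_quotient (q :: s) m).1.
Proof.
move=> ps m0 eX.
(* Any real closed field would do, since only the square root of 5 is required. *)
pose R : rcfType := realalg.
have [a a1 a2] := golden_ratio_exists R.
have [lo _] := fib_quotient_golden a1 a2 ps m0.
move: lo; rewrite eX.
set x := fib_quotient (q :: s) m => lo.
have a0 : (0 < a)%R by apply: Order.POrderTheory.lt_le_trans a1.
have U := fib_le_golden X.+1 a2.
rewrite -(Num.Theory.ler_nat R) GRing.natrM.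
move: lo; rewrite GRing.exprD GRing.mulrAC Num.Theory.ler_pM2r ?Num.Theory.exprn_gt0 //.
apply: Order.POrderTheory.le_trans; apply: Num.Theory.ler_wpM2r => //.
by rewrite -(Num.Theory.ler_pM2r a0) -GRing.exprSr.
Qed.

(** * Totient against radical for even indices *)

(* Used with phi = totient n, L = 2 ^ (r - 1) for r the number of primes of n, and R = rad n. *)
Definition fib_dominates (phi L R : nat) : Prop :=
  exists X, phi = X + L /\ R < fib X.+1.

(** The new X solves (q-1)(X + L) = X' + 2L. Then F_{X'+1} >= F_{X+1}^(q-1) > r^(q-1) >= r q, the
    last step because 2^(q-2) >= q for q >= 5. *)
Lemma fib_dominates_mul phi L r q : 2 <= r -> 5 <= q ->
  fib_dominates phi L r -> fib_dominates (phi * q.-1) (L * 2) (r * q).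
Proof.
move=> r2 q5 [X [-> rX]]; exists (q.-1 * X + (q - 3) * L); split.
  by case: q q5 => [|[|[|q]]] //= _; rewrite !subSS subn0; ring.
apply: (@leq_trans (fib (q.-1 * X).+1)); last by apply: leq_fib; rewrite ltnS leq_addr.
apply: leq_trans (leq_fibX _ _).
apply: (@leq_trans (r.+1 ^ q.-1)); last by rewrite leq_exp2r //; lia.
apply: (@leq_ltn_trans (r ^ q.-1)); last by rewrite ltn_exp2r //; lia.
have [j ->] : exists j, q = j + 5 by exists (q - 5); lia.
have -> : (j + 5).-1 = (j + 3).+1 by lia.
rewrite expnS leq_mul2l; apply/orP; right.
apply: (@leq_trans (2 ^ (j + 3))); last by rewrite leq_exp2r; lia.
by elim: j => // j IH; rewrite !addSn expnS; lia.
Qed.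

Lemma fib_dominates_prod phi L r l : 2 <= r -> all (leq 5) l ->
  fib_dominates phi L r ->
  fib_dominates (phi * \prod_(q <- l) q.-1) (L * 2 ^ size l) (r * \prod_(q <- l) q).
Proof.
elim: l phi L r => [|q l IH] phi L r r2 /=; first by rewrite !big_nil !muln1.
case/andP=> q5 l5 h; rewrite !big_cons expnS !mulnA.
apply: IH => //; last exact: fib_dominates_mul.
by apply: leq_trans r2 _; rewrite leq_pmulr //; lia.
Qed.

(** A linear function against Fibonacci growth: when q grows by 1 the left side gains c, while the
    right side gains at least F_{x0-1} >= c. *)
Lemma ltn_mul_fib c q0 x0 q x : c * q0 < fib x0 -> c <= fib x0.-1 -> 1 < x0 -> q0 <= q ->
  x0 + (q - q0) <= x -> c * q < fib x.
Proof.
move=> h1 h2 x01 qq xx; apply: leq_trans (leq_fib xx).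
rewrite -{1}(subnKC qq); elim: (q - q0) => [|j IH]; first by rewrite !addn0.
case: x0 h1 h2 x01 {xx} IH => [|[|x0]] // h1 h2 _ IH.
have {}h2 : c <= fib x0.+1 := h2.
have -> : x0.+2 + j.+1 = (x0 + j.+1).+2 by lia.
rewrite fibSS; have := @leq_fib x0.+1 (x0 + j.+1); rewrite addnS.
have -> : (x0 + j).+2 = x0.+2 + j by lia.
lia.
Qed.

Lemma prime_5_7 q : prime q -> 5 <= q -> q < 11 -> q = 5 \/ q = 7.
Proof.
by case: q => [|[|[|[|[|[|[|[|[|[|[|q]]]]]]]]]]] // _ _ _; [left | right].
Qed.

(** A base part made of [m], 2, possibly 3, and at most two further primes is checked directly; all
    remaining primes are at least 5 and enter through [fib_dominates_prod]. The excluded numbers are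
    those for which no such base part is available. *)
Lemma fib_dominates_even m l : 0 < m -> all prime l -> sorted ltn (2 :: l) ->
  \prod_(q <- 2 :: l) q * m \notin [:: 2; 4; 6; 10; 12; 14; 18; 30; 42] ->
  fib_dominates (m * \prod_(q <- 2 :: l) q.-1) (2 ^ size l) (\prod_(q <- 2 :: l) q).
Proof.
move=> m0 pl sl nn.
have step phi L r l' : 2 <= r -> all (leq 5) l' -> fib_dominates phi L r ->
    m * \prod_(q <- 2 :: l) q.-1 = phi * \prod_(q <- l') q.-1 ->
    2 ^ size l = L * 2 ^ size l' ->
    \prod_(q <- 2 :: l) q = r * \prod_(q <- l') q ->
    fib_dominates (m * \prod_(q <- 2 :: l) q.-1) (2 ^ size l) (\prod_(q <- 2 :: l) q).
  by move=> r2 l5 h -> -> ->; exact: fib_dominates_prod.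
have tail a b l' : a < b -> path ltn b l' -> all (leq a.+1) l'.
  move=> ab pbl; apply/allP => x xl.
  have /allP/(_ x xl) := order_path_min ltn_trans pbl; lia.
case: l pl sl nn step => [|q l] /=.
  rewrite !big_cons !big_nil !muln1 => _ _ nn _.
  have m4 : 4 <= m by case: m m0 nn => [|[|[|[|m]]]].
  exists m.-1; split; first by lia.
  by rewrite prednK //; apply: (@leq_trans (fib 4)) => //; exact: leq_fib.
case/andP=> pq pl /andP[q2 sl] nn step.
have q5 : q = 3 \/ 5 <= q.
  by case: q q2 pq {sl nn step} => [|[|[|[|[|q]]]]] //; [left | right].
case: q5 => [e3 | q5]; last first.
  have l5 : all (leq 5) l by apply: (@tail 4 q).
  have [m2|m1] := leqP 2 m.
    apply: (step (m * q.-1) 2 (2 * q) l) => //; try by rewrite ?big_cons ?expnS /=; ring.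
      by lia.
    exists (m * q.-1 - 2); split; first by nia.
    (* The arguments are c, a lower bound for q and a suitable x0: here 2 * 5 < F_7 = 13, and X + 1
       is at least 7 from m = 2, q = 5 on. The later calls follow the same pattern. *)
    by apply: (@ltn_mul_fib 2 5 7) => //; nia.
  have em : m = 1 by lia.
  have [q11|q11] := leqP 11 q.
    apply: (step q.-1 2 (2 * q) l) => //; try by rewrite ?em ?big_cons ?expnS /=; ring.
      by lia.
    exists (q.-1 - 2); split; first by lia.
    by apply: (@ltn_mul_fib 2 11 9) => //; lia.
  have q57 : q = 5 \/ q = 7.
    exact: prime_5_7.
  case: l pl sl l5 nn step tail => [|r l] /=.
    by rewrite !big_cons !big_nil em; case: q57 => ->.
  case/andP=> pr pl /andP[qr sl] /andP[r5 l5] nn step tail.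
  case: q57 => eq; subst q.
    apply: (step (4 * r.-1) 4 (10 * r) l) => //; try by rewrite ?em ?big_cons ?expnS /=; ring.
      by lia.
    exists (4 * r.-1 - 4); split; first by lia.
    by apply: (@ltn_mul_fib 10 7 12) => //; have : r != 6 by [apply: contraTneq pr => ->]; lia.
  apply: (step (6 * r.-1) 4 (14 * r) l) => //; try by rewrite ?em ?big_cons ?expnS /=; ring.
    by lia.
  exists (6 * r.-1 - 4); split; first by lia.
  by apply: (@ltn_mul_fib 14 8 12) => //; lia.
clear pq q2; subst q; case: l pl sl nn step => [|q l] /=.
  rewrite !big_cons !big_nil => _ _ nn _.
  have m4 : 4 <= m by case: m m0 nn => [|[|[|[|m]]]].
  exists (m * 2 - 2); split; first by lia.
  by apply: (@leq_trans (fib 7)) => //; apply: leq_fib; lia.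
case/andP=> pq pl /andP[q3 sl] nn step.
have q5 : 5 <= q by case: q q3 pq {sl nn step} => [|[|[|[|[|q]]]]].
have l5 : all (leq 5) l by apply: (@tail 4 q).
have [m2|m1] := leqP 2 m.
  apply: (step (m * 2 * q.-1) 4 (6 * q) l) => //; try by rewrite ?big_cons ?expnS /=; ring.
    by lia.
  exists (m * 2 * q.-1 - 4); split; first by nia.
  by apply: (@ltn_mul_fib 6 5 10) => //; nia.
have em : m = 1 by lia.
have [q11|q11] := leqP 11 q.
  apply: (step (2 * q.-1) 4 (6 * q) l) => //; try by rewrite ?em ?big_cons ?expnS /=; ring.
    by lia.
  exists (2 * q.-1 - 4); split; first by lia.
  by apply: (@ltn_mul_fib 6 11 11) => //; lia.
have q57 : q = 5 \/ q = 7.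
  exact: prime_5_7.
case: l pl sl l5 nn step tail => [|r l] /=.
  by rewrite !big_cons !big_nil em; case: q57 => ->.
case/andP=> pr pl /andP[qr sl] /andP[r5 l5] nn step tail.
case: q57 => eq; subst q.
  apply: (step (8 * r.-1) 8 (30 * r) l) => //; try by rewrite ?em ?big_cons ?expnS /=; ring.
    by lia.
  exists (8 * r.-1 - 8); split; first by lia.
  by apply: (@ltn_mul_fib 30 7 14) => //; have : r != 6 by [apply: contraTneq pr => ->]; lia.
apply: (step (12 * r.-1) 8 (42 * r) l) => //; try by rewrite ?em ?big_cons ?expnS /=; ring.
  by lia.
exists (12 * r.-1 - 8); split; first by lia.
by apply: (@ltn_mul_fib 42 8 15) => //; lia.
Qed.

(** * Primitive primes at even indices *)

Definition primitive_prime (p n : nat) : Prop :=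
  [/\ prime p, p %| fib n & forall d, 0 < d < n -> ~~ (p %| fib d)].

(** Consecutive Fibonacci numbers reduced modulo p, so that F_42 can be tested without a huge unary
    number. *)
Fixpoint fib_mod (p n : nat) : nat * nat :=
  if n is n'.+1 then let x := fib_mod p n' in (x.2, (x.1 + x.2) %% p) else (0, 1).

Lemma fib_modE p n : 1 < p -> fib_mod p n = (fib n %% p, fib n.+1 %% p).
Proof.
move=> p1; elim: n => [|n IH]; first by rewrite /= mod0n modn_small.
rewrite [LHS]/= IH [(_, _).1]/= [(_, _).2]/= modnDm addnC.
by rewrite -fibSS.
Qed.

Lemma primitive_prime_check p n : prime p -> (fib_mod p n).1 == 0 ->
  all (fun d => (fib_mod p d).1 != 0) (iota 1 n.-1) -> primitive_prime p n.
Proof.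
move=> pp; have p1 := prime_gt1 pp.
rewrite fib_modE // => h /allP hd; split => // d /andP[d0 dn].
have := hd d; rewrite fib_modE // mem_iota d0 /= => h'; apply: h'.
by rewrite add1n prednK //; lia.
Qed.

Lemma dvdn_prod_primes n s : 0 < n -> uniq s -> {subset s <= primes n} ->
  \prod_(q <- s) q %| n.
Proof.
move=> n0; elim: s => [|q s IH] /=; first by rewrite big_nil dvd1n.
case/andP=> qs us sn; rewrite big_cons.
have pq x : x \in q :: s -> prime x by move=> /sn; rewrite mem_primes => /andP[].
have qn : q %| n by have := sn q (mem_head _ _); rewrite mem_primes n0 => /andP[].
rewrite Gauss_dvd ?qn ?IH // => [x xs|]; first by rewrite sn // inE xs orbT.
rewrite big_seq; apply: (big_ind (coprime q)); first exact: coprimen1.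
  by move=> x y; rewrite coprimeMr => -> ->.
move=> x xs; rewrite prime_coprime ?pq ?mem_head // dvdn_prime2 ?pq ?mem_head ?inE ?xs ?orbT //.
by apply: contraNneq qs => ->.
Qed.

(** Q divides rad n, with the denominator cleared. The valuations are compared prime by prime:
    [fdiff_logn_fib] bounds the excess by [p | n], which is at most the valuation of rad n. *)
Lemma fib_quotient_dvd n m s : 0 < n -> n != 6 -> n = \prod_(q <- s) q * m ->
  uniq s -> s =i primes n ->
  (forall p, prime p -> p %| fib n -> exists2 d, 0 < d < n & p %| fib d) ->
  (fib_quotient s m).1 %| (fib_quotient s m).2 * \prod_(q <- s) q.
Proof.
move=> n0 n6 en us sn nprim.
have ps : all prime s by apply/allP=> q; rewrite sn mem_primes => /andP[].
have := n0; rewrite {1}en muln_gt0 => /andP[r0 m0].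
have /andP[N0 D0] := fib_quotient_gt0 ps m0.
apply/dvdn_partP => // p; rewrite mem_primes => /andP[pp _].
rewrite p_part pfactor_dvdn ?muln_gt0 ?D0 // lognM //.
have := fdiff_logn_fib pp n0 n6 en us sn (nprim p pp).
rewrite -logn_fib_quotient //.
have : (p %| n)%N <= logn p (\prod_(q <- s) q).
  case pn: (p %| n) => //; rewrite logn_gt0 mem_primes pp r0 /=.
  have pins : p \in s by rewrite sn mem_primes pp n0.
  by rewrite (perm_big _ (perm_to_rem pins)) big_cons dvdn_mulr.
lia.
Qed.

Lemma primitive_prime_even n : ~~ odd n -> 4 <= n -> n != 6 -> n != 12 ->
  exists p, primitive_prime p n.
Proof.
move=> evn n4 n6 n12.
have [|nexc] := boolP (n \in [:: 2; 4; 6; 10; 12; 14; 18; 30; 42]).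
  rewrite !inE (negbTE n6) (negbTE n12) /=.
  case/orP => [/eqP e|]; first by rewrite e in n4.
  case/orP => [/eqP ->|]; first by exists 3; apply: primitive_prime_check; vm_compute.
  case/orP => [/eqP ->|]; first by exists 11; apply: primitive_prime_check; vm_compute.
  case/orP => [/eqP ->|]; first by exists 29; apply: primitive_prime_check; vm_compute.
  case/orP => [/eqP ->|]; first by exists 19; apply: primitive_prime_check; vm_compute.
  case/orP => [/eqP ->|/eqP ->]; first by exists 31; apply: primitive_prime_check; vm_compute.
  by exists 211; apply: primitive_prime_check; vm_compute.
have n0 : 0 < n by lia.
(* Primitivity is decidable on the finite list of primes of [fib n], so either a witness is found
   there or every such prime divides an earlier term. *)
set prim := fun p => all (fun d => ~~ (p %| fib d)) (iota 1 n.-1).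
have [/hasP[p]|/hasPn nprim] := boolP (has prim (primes (fib n))).
  rewrite mem_primes => /and3P[pp _ pn] /allP ph; exists p; split=> // d /andP[d0 dn].
  by apply: ph; rewrite mem_iota d0 add1n prednK.
have {}nprim p : prime p -> p %| fib n -> exists2 d, 0 < d < n & p %| fib d.
  move=> pp pn; have := nprim p; rewrite mem_primes pp fib_gt0 // pn => /(_ isT).
  case/allPn => d; rewrite mem_iota add1n prednK // negbK => dn pd.
  by exists d.
have us := primes_uniq n.
have rn : \prod_(q <- primes n) q %| n by apply: dvdn_prod_primes.
set m := n %/ \prod_(q <- primes n) q.
have en : n = \prod_(q <- primes n) q * m by rewrite mulnC divnK.
have m0 : 0 < m by move: n0; rewrite {1}en muln_gt0 => /andP[].
have ps : all prime (primes n) by apply/allP=> q; rewrite mem_primes => /andP[].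
have [l el] : exists l, primes n = 2 :: l.
  have p2 : 2 \in primes n by rewrite mem_primes n0 dvdn2 evn.
  have := sorted_primes n; case: (primes n) ps p2 => [|q l] //= /andP[pq _].
  rewrite inE => /orP[/eqP <-|l2 ql]; first by exists l.
  have /allP/(_ 2 l2) := order_path_min ltn_trans ql.
  by have := prime_gt1 pq; lia.
have dv := fib_quotient_dvd n0 n6 en us (fun=> erefl) nprim.
have sl := sorted_primes n.
rewrite el in en us ps sl dv; have pl := ps; case/andP: pl => _ pl.
have /andP[N0 D0] := fib_quotient_gt0 ps m0.
rewrite en in nexc.
have [X [eX rX]] := fib_dominates_even m0 pl sl nexc.
have lo := fib_quotient_lower ps m0 eX.
have r0 : 0 < \prod_(q <- 2 :: l) q by move: n0; rewrite {1}en muln_gt0 => /andP[].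
have hi : _ <= _ := dvdn_leq _ dv; rewrite muln_gt0 D0 r0 in hi.
have {hi} := leq_trans lo (hi isT).
by rewrite mulnC leq_pmul2l // leqNgt rX.
Qed.

(** * Cassini-type identities and cancellation of primitive factors *)

Lemma fib_cassini j : fib j.*2 * fib j.*2.+2 + 1 = fib j.*2.+1 ^ 2.
Proof.
elim: j => [//|j IH]; rewrite doubleS (fibSS j.*2.+2) (fibSS j.*2.+1).
move: IH; rewrite fibSS; set x := fib j.*2; set y := fib j.*2.+1; nia.
Qed.

(** The choice of [eps] makes both indices even, which fixes the sign as +1. The even case reduces
    to Cassini's identity at m - 2. For m = 1 and m = 2 the lower index is 0. *)
Lemma fib_catalan m : 1 <= m -> fib (m - eps m) * fib (m + eps m) + 1 = fib m ^ 2.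
Proof.
move=> m1; have := odd_double_half m; rewrite /eps; case: (odd m) => em.
  have -> : m - 1 = m./2.*2 by lia.
  have -> : m + 1 = m./2.*2.+2 by lia.
  by rewrite fib_cassini -[m in RHS]em.
have [j ej] : exists j, m = j.*2.+2 by exists (m./2.-1); lia.
rewrite ej addn2 subSS subSS subn0.
have := fib_cassini j; rewrite !fibSS.
set x := fib j.*2; set y := fib j.*2.+1; nia.
Qed.

(** The primitive prime divides some F_i of the product, and its rank is c, so i = j c. Here j = 0
    would make the product zero, and j >= 2 is excluded by the last hypothesis. *)
Lemma primitive_prime_mem p c X s : primitive_prime p c -> 0 < c -> 0 < X ->
  \prod_(i <- s) fib i = fib c * X ->
  (forall j, 2 <= j -> ~~ (fib (j * c) %| fib c * X)) -> c \in s.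
Proof.
move=> [pp pc pmin] c0 X0 es hj.
have /hasP[i si pi] : has (fun i => p %| fib i) s.
  have : p %| \prod_(i <- s) fib i by rewrite es dvdn_mulr.
  elim: s {es} => [|i s IH]; first by rewrite big_nil dvdn1 => /eqP p1; move: pp; rewrite p1.
  by rewrite big_cons Euclid_dvdM //= => /orP[-> //|/IH ->]; rewrite orbT.
have [z z0 zP] := fib_rank pp c0 pc.
have ez : z = c.
  have zc : z %| c by rewrite -zP.
  have := dvdn_leq c0 zc; rewrite leq_eqVlt => /orP[/eqP //|zlt].
  by have := pmin z; rewrite z0 zlt zP dvdnn => /(_ isT).
have [j ej] : exists j, i = j * c by apply/dvdnP; rewrite -ez -zP.
have is_dvd : fib i %| fib c * X.
  by rewrite -es (perm_big _ (perm_to_rem si)) big_cons dvdn_mulr.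
case: j ej => [|[|j]] ej.
- by move: is_dvd; rewrite ej dvd0n muln_eq0 !eqn0Ngt X0 fib_gt0.
- by rewrite -(mul1n c) -ej.
by have := hj j.+2 isT; rewrite -ej is_dvd.
Qed.

Lemma fib_factor_even c X s : ~~ odd c -> 4 <= c -> c != 6 -> c != 12 -> 0 < X ->
  (forall j, 2 <= j -> ~~ (fib (j * c) %| fib c * X)) ->
  sorted leq s -> all (leq 3) s -> \prod_(i <- s) fib i = fib c * X ->
  exists r, [/\ sorted leq r, all (leq 3) r, s = sort leq (c :: r) &
                \prod_(i <- r) fib i = X].
Proof.
move=> evc c4 c6 c12 X0 hj ss s3 es.
have [p pP] := primitive_prime_even evc c4 c6 c12.
have c0 : 0 < c by lia.
have cs := primitive_prime_mem pP c0 X0 es hj.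
exists (rem c s); split.
- exact: (subseq_sorted leq_trans (rem_subseq c s) ss).
- by apply/allP => x /mem_rem xs; apply: (allP s3).
- rewrite -[LHS](sorted_sort leq_trans ss).
  by apply/(perm_sortP leq_total leq_trans anti_leq); apply: perm_to_rem.
apply/eqP; rewrite -(eqn_pmul2l (fib_gt0 c0)) -es.
by rewrite (perm_big _ (perm_to_rem cs)) big_cons.
Qed.

(** By size: F_{2c} = F_c (F_{c+1} + F_{c-1}) exceeds F_c X. *)
Lemma fib_double_ndvd c X j : 2 <= c -> 0 < X -> X <= fib c.+1 -> 2 <= j ->
  ~~ (fib (j * c) %| fib c * X).
Proof.
move=> c2 X0 hX j2; have c0 : 0 < fib c by apply: fib_gt0; lia.
apply/negP => /dvdn_leq; rewrite muln_gt0 c0 X0 => /(_ isT).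
rewrite leqNgt; apply/negP; rewrite negbK.
apply: (@leq_trans (fib (c + c))); last by apply: leq_fib; nia.
case: c c2 c0 hX => [|[|c]] // _ c0 hX; rewrite fibD.
by have := @fib_gt0 c.+1 isT; nia.
Qed.

(** * Factorizations of 3, 8 and 144 into Fibonacci numbers *)

(** The fuel [k] bounds the number of factors. Indices stop below 13 because F_13 = 233 exceeds 144,
    the largest number to be factored. *)
Fixpoint fib_factorizations (k lo X : nat) : seq (seq nat) :=
  if X == 1 then [:: [::]] else
  if k is k'.+1 then
    flatten [seq map (cons i) (fib_factorizations k' i (X %/ fib i))
            | i <- [seq i <- iota lo (13 - lo) | fib i %| X]]
  else [::].

(** Completeness of the enumeration; every factor is at least 2, so a product below 2^k has fewer
    than k factors and the fuel suffices. *)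
Lemma fib_factorizationsP k lo s : 3 <= lo -> sorted leq s -> all (leq lo) s ->
  \prod_(i <- s) fib i < 233 -> \prod_(i <- s) fib i < 2 ^ k ->
  s \in fib_factorizations k lo (\prod_(i <- s) fib i).
Proof.
elim: k lo s => [|k IH] lo s lo3 ss sl.
  have : 0 < \prod_(i <- s) fib i.
    rewrite big_seq prodn_cond_gt0 // => i si; apply: fib_gt0.
    by have := allP sl i si; lia.
  by case: (\prod_(i <- s) _).
case: s ss sl => [|i s] /=; first by rewrite big_nil mem_seq1.
move=> pis /andP[li sl]; rewrite big_cons; set Y := \prod_(j <- s) fib j => h1 h2.
have i3 : 3 <= i by apply: leq_trans li.
have f2 := fib_ge2 i3.
have sli : all (leq i) s by apply: order_path_min pis; exact: leq_trans.
have Y0 : 0 < Y.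
  rewrite /Y big_seq prodn_cond_gt0 // => j sj; apply: fib_gt0.
  by have := allP sli j sj; lia.
have -> : fib i * Y == 1 = false by apply/eqP; nia.
apply/flatten_mapP; exists i.
  rewrite mem_filter dvdn_mulr // mem_iota li /=.
  have i13 : i < 13.
    rewrite ltnNge; apply/negP => /leq_fib; have -> : fib 13 = 233 by [].
    nia.
  lia.
rewrite mulKn; last by lia.
apply: map_f; apply: IH => //.
- exact: path_sorted pis.
- by rewrite -/Y; nia.
- by rewrite -/Y; move: h2; rewrite expnS; nia.
Qed.

Lemma fib_prod_3 s : sorted leq s -> all (leq 3) s -> \prod_(i <- s) fib i = 3 -> s = [:: 4].
Proof.
move=> ss s3 es; have := fib_factorizationsP (k := 8) (leqnn 3) ss s3.
rewrite es => /(_ isT isT).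
have -> : fib_factorizations 8 3 3 = [:: [:: 4]] by vm_compute.
by rewrite inE => /eqP.
Qed.

Lemma fib_prod_8 s : sorted leq s -> all (leq 3) s -> \prod_(i <- s) fib i = 8 ->
  s = [:: 6] \/ s = [:: 3; 3; 3].
Proof.
move=> ss s3 es; have := fib_factorizationsP (k := 8) (leqnn 3) ss s3.
rewrite es => /(_ isT isT).
have -> : fib_factorizations 8 3 8 = [:: [:: 3; 3; 3]; [:: 6]] by vm_compute.
by rewrite !inE => /orP[] /eqP ->; [right | left].
Qed.

Lemma fib_prod_144 s : sorted leq s -> all (leq 3) s -> \prod_(i <- s) fib i = 144 ->
  s = [:: 12] \/ s \in A_indices.
Proof.
move=> ss s3 es; have := fib_factorizationsP (k := 8) (leqnn 3) ss s3.
rewrite es => /(_ isT isT).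
have -> : fib_factorizations 8 3 144 =
  [:: [:: 3; 3; 3; 3; 4; 4]; [:: 3; 4; 4; 6]; [:: 12]] by vm_compute.
by rewrite !inE => /or3P[] /eqP ->; [right | right | left].
Qed.

(** * Classification for m >= 5 *)

(** The larger index b is cancelled first: its cofactor F_a is below F_{b+1}, so no proper multiple
    of b can occur. Then a is cancelled with cofactor 1, and an empty product remains. *)
Lemma classify_generic m s : 5 <= m ->
  m - eps m \notin [:: 6; 12] -> m + eps m \notin [:: 6; 12] ->
  sorted leq s -> all (leq 3) s ->
  \prod_(i <- s) fib i = fib (m - eps m) * fib (m + eps m) ->
  s = [:: m - eps m; m + eps m].
Proof.
move=> m5; rewrite !inE !negb_or => /andP[a6 a12] /andP[b6 b12] ss s3.
set a := m - eps m in a6 a12 *; set b := m + eps m in b6 b12 *.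
rewrite mulnC => es.
have [a4 ab eva evb] : [/\ 4 <= a, a < b, ~~ odd a & ~~ odd b].
  rewrite /a /b /eps; case om: (odd m); split; lia.
have fa0 : 0 < fib a by apply: fib_gt0; lia.
have b4 : 4 <= b by lia.
have nb j : 2 <= j -> ~~ (fib (j * b) %| fib b * fib a).
  by apply: fib_double_ndvd => //; [lia | apply: leq_fib; lia].
have na j : 2 <= j -> ~~ (fib (j * a) %| fib a * 1).
  by apply: fib_double_ndvd => //; [lia | exact: fib_gt0].
have [r [sr r3 -> er]] := fib_factor_even evb b4 b6 b12 fa0 nb ss s3 es.
rewrite -[RHS in _ = RHS]muln1 in er.
have [t [_ t3 -> et]] := fib_factor_even eva a4 a6 a12 (ltnSn 0) na sr r3 er.
have -> : t = [::].
  case: t t3 et => //= i t /andP[i3 _]; rewrite big_cons => /eqP.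
  by rewrite muln_eq1 => /andP[/eqP f1 _]; have := fib_ge2 i3; rewrite f1.
apply: (sorted_eq leq_trans anti_leq).
- exact: (sort_sorted leq_total).
- by rewrite /= andbT ltnW.
by rewrite perm_sort (perm_catC [:: b] [:: a]).
Qed.

(** Serves the cases where X = 8 or 144 is larger than F_{c+1}. The multiple 2c is tested by
    computation and the others are excluded by size; e may lie below 3c, which keeps the computed
    F_e small. *)
Lemma fib_triple_ndvd c X e j : 0 < c -> 0 < X -> e <= 3 * c -> fib c * X < fib e ->
  ~~ (fib (2 * c) %| fib c * X) -> 2 <= j -> ~~ (fib (j * c) %| fib c * X).
Proof.
move=> c0 X0 ec h3 h2; case: j => [|[|[|j]]] // _; apply/negP => /dvdn_leq.
rewrite muln_gt0 fib_gt0 // => /(_ X0); rewrite leqNgt => /negP; apply.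
apply: leq_trans h3 (leq_fib _); apply: leq_trans ec _.
by rewrite leq_pmul2r.
Qed.

Definition listed_solution (m : nat) (s : seq nat) : Prop :=
  (m, s) \in sporadic_solutions \/ (5 <= m /\ s = [:: m - eps m; m + eps m]).

Lemma classify_ge5 m s : 5 <= m -> sorted leq s -> all (leq 3) s ->
  \prod_(i <- s) fib i + 1 = fib m ^ 2 -> listed_solution m s.
Proof.
move=> m5 ss s3; rewrite -fib_catalan ?(leq_trans _ m5) // => /eqP.
rewrite eqn_add2r => /eqP es.
have f6 : fib 6 = 8 by [].
have f12 : fib 12 = 144 by vm_compute.
(* These are exactly the m >= 5 for which m - [eps m] or m + [eps m] is 6 or 12. *)
have [|nexc] := boolP (m \in [:: 5; 7; 8; 10; 11; 13; 14]); last first.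
  right; split=> //; apply: classify_generic => //; move: nexc m5;
    rewrite !inE /eps; case om: (odd m); lia.
have n4 j : 2 <= j -> ~~ (fib (j * 4) %| fib 4 * 8).
  by apply: (@fib_triple_ndvd 4 8 12); vm_compute.
have n10 j : 2 <= j -> ~~ (fib (j * 10) %| fib 10 * 144).
  by apply: (@fib_triple_ndvd 10 144 21); vm_compute.
have n8 j : 2 <= j -> ~~ (fib (j * 8) %| fib 8 * 144).
  by apply: (@fib_triple_ndvd 8 144 19); vm_compute.
(* After cancelling F_c, the remaining 8 is either F_6, giving the infinite family, or F_3^3, giving
   a sporadic solution. [s144] does the same with F_12 and the two products A. *)
have s8 c : ~~ odd c -> 4 <= c -> c != 6 -> c != 12 ->
    (forall j, 2 <= j -> ~~ (fib (j * c) %| fib c * 8)) ->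
    \prod_(i <- s) fib i = fib c * fib 6 ->
    s = sort leq [:: c; 6] \/ s = sort leq [:: c; 3; 3; 3].
  move=> h1 h2 h3 h4 h5; rewrite f6 => h6.
  have [r [sr r3 -> er]] := fib_factor_even h1 h2 h3 h4 (ltn0Sn 7) h5 ss s3 h6.
  by have [->|->] := fib_prod_8 sr r3 er; [left | right].
have s144 c : ~~ odd c -> 4 <= c -> c != 6 -> c != 12 ->
    (forall j, 2 <= j -> ~~ (fib (j * c) %| fib c * 144)) ->
    \prod_(i <- s) fib i = fib c * fib 12 ->
    s = sort leq [:: c; 12] \/ exists2 A, A \in A_indices & s = sort leq (c :: A).
  move=> h1 h2 h3 h4 h5; rewrite f12 => h6.
  have [r [sr r3 -> er]] := fib_factor_even h1 h2 h3 h4 (ltn0Sn 143) h5 ss s3 h6.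
  by have [->|rA] := fib_prod_144 sr r3 er; [left | right; exists r].
rewrite /listed_solution.
rewrite !inE => /or4P[/eqP em|/eqP em|/eqP em|/or4P[]/eqP em]; subst m.
- have [->|->] := s8 4 isT isT isT isT n4 es; first by right.
by left; vm_compute.
- have h j : 2 <= j -> ~~ (fib (j * 8) %| fib 8 * 8) by exact: fib_double_ndvd.
  rewrite mulnC in es; have [->|->] := s8 8 isT isT isT isT h es; first by right.
  by left; vm_compute.
- have h j : 2 <= j -> ~~ (fib (j * 10) %| fib 10 * 8) by exact: fib_double_ndvd.
  rewrite mulnC in es; have [->|->] := s8 10 isT isT isT isT h es; first by right.
  by left; vm_compute.
- have [->|[A hA ->]] := s144 8 isT isT isT isT n8 es; first by right.
by left; move: hA; rewrite /A_indices !inE => /orP[] /eqP ->; vm_compute.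
- have [->|[A hA ->]] := s144 10 isT isT isT isT n10 es; first by right.
by left; move: hA; rewrite /A_indices !inE => /orP[] /eqP ->; vm_compute.
- have h j : 2 <= j -> ~~ (fib (j * 14) %| fib 14 * 144).
    by apply: fib_double_ndvd => //; vm_compute.
  rewrite mulnC in es; have [->|[A hA ->]] := s144 14 isT isT isT isT h es; first by right.
  by left; move: hA; rewrite /A_indices !inE => /orP[] /eqP ->; vm_compute.
have h j : 2 <= j -> ~~ (fib (j * 16) %| fib 16 * 144).
  by apply: fib_double_ndvd => //; vm_compute.
rewrite mulnC in es; have [->|[A hA ->]] := s144 16 isT isT isT isT h es; first by right.
by left; move: hA; rewrite /A_indices !inE => /orP[] /eqP ->; vm_compute.
Qed.

(** * The two directions of the classification *)

(** Plain sequences replace tuples, so that case analysis on [s] is free of the dependent length. *)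
Definition nontrivial_solution (m : nat) (s : seq nat) : Prop :=
  [/\ 1 <= size s, sorted leq s, \prod_(i <- s) fib i + 1 = fib m ^ 2 &
      size s = 1 \/ 2 <= size s /\ 3 <= head 0 s].

Lemma nontrivial_solutionE m k (n : k.-tuple nat) :
  is_solution m n /\ nontrivial n <-> nontrivial_solution m n.
Proof.
rewrite /nontrivial_solution size_tuple.
by split=> [[[h1 h2 h3] h4] | [h1 h2 h3 h4]]; split.
Qed.

(** Every listed product equals F_{m - eps} F_{m + eps}, so all the equations come from
    [fib_catalan], including those with m < 5. *)
Lemma listed_nontrivial_solution m s : listed_solution m s -> nontrivial_solution m s.
Proof.
have prodA A c : A \in A_indices -> \prod_(i <- rcons A c) fib i = fib 12 * fib c.
  move=> hA; rewrite -cats1 big_cat big_seq1; congr muln.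
  by move: hA; rewrite !inE => /orP[] /eqP ->; rewrite !big_cons big_nil; vm_compute.
have solA A c a : A \in A_indices -> 6 <= c -> 1 <= a ->
    fib 12 * fib c = fib (a - eps a) * fib (a + eps a) -> nontrivial_solution a (rcons A c).
  move=> hA c6 a1 e; split; last 1 first.
  - by right; move: hA; rewrite !inE => /orP[] /eqP ->.
  - by rewrite size_rcons.
  - by move: hA; rewrite !inE => /orP[] /eqP -> /=; rewrite andbT; lia.
  by rewrite prodA // e; exact: fib_catalan.
case; last first.
  case=> m5 ->; split=> //.
  - by rewrite /= andbT; apply: leq_trans (leq_subr _ _) (leq_addr _ _).
  - by rewrite !big_cons big_nil muln1; apply: fib_catalan; lia.
  by right; split=> //=; rewrite /eps; case: (odd m) (odd_double_half m); lia.
(* The product is restated as a [foldr] so that it evaluates by computation. *)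
have small a t : 1 <= size t -> sorted leq t -> (size t == 1) || (2 <= size t) && (3 <= head 0 t) ->
    foldr (fun i x => fib i * x) 1 t == fib (a - eps a) * fib (a + eps a) -> 1 <= a ->
    nontrivial_solution a t.
  move=> h1 h2 h3 /eqP h4 a1; split=> //; last by case/orP: h3 => [/eqP|/andP]; [left | right].
  by rewrite unlock /= [reducebig _ _ _]h4; exact: fib_catalan.
rewrite /sporadic_solutions !mem_cat => /orP[|/or4P[]].
- by rewrite !inE => /or4P[|||/or4P[|||/orP[]]] /eqP [-> ->]; apply: small; vm_compute.
- by case/mapP => A hA [-> ->]; apply: solA; rewrite // mulnC.
- by case/mapP => A hA [-> ->]; apply: solA; rewrite // mulnC.
- by case/mapP => A hA [-> ->]; apply: solA.
by case/mapP => A hA [-> ->]; apply: solA.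
Qed.

Lemma nontrivial_solution_listed m s : nontrivial_solution m s -> listed_solution m s.
Proof.
case=> s1 ss es nt.
have [s3|ns3] := boolP (3 <= head 0 s); last first.
  (* A head below 3 forces k = 1. Index 0 gives F_m^2 = 1, so m is 1 or 2; indices 1 and 2 give
     F_m^2 = 2, which is impossible. *)
  have [i ei i3] : exists2 i, s = [:: i] & i < 3.
    case: nt => [/eqP|[_ h]]; last by rewrite h in ns3.
    by case: s ns3 {s1 ss es} => [|i [|j s]] //= i3 _; exists i; rewrite // ltnNge.
  subst s; move: es; rewrite big_cons big_nil muln1.
  have nosq x : 2 <> x ^ 2 by case: x => [|[|x]] //; rewrite !expnS; nia.
  case: i i3 {s1 ss nt ns3} => [|[|[|i]]] // _ e.
  - case: m e => [|[|[|m]]] // e; try by left.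
    have := @fib_ge2 m.+3 isT; have : 1 = fib m.+3 * fib m.+3 by rewrite -[RHS]e.
    by move: (fib m.+3) => x; nia.
  - by case: (nosq (fib m)).
  by case: (nosq (fib m)).
have {}s3 : all (leq 3) s.
  case: s s1 ss s3 {es nt} => //= i s _ pis i3; rewrite i3 /=.
  by apply: order_path_min (path_le leq_trans i3 pis); exact: leq_trans.
have P0 : 0 < \prod_(i <- s) fib i.
  by rewrite big_seq prodn_cond_gt0 // => i si; apply: fib_gt0; have := allP s3 i si; lia.
have [m5|] := leqP 5 m; first exact: classify_ge5.
(* For m <= 2 the positive product leaves no room; m = 3 gives product 3 and m = 4 gives product
   8. *)
case: m es => [|[|[|[|[|m]]]]] // es _; try by move: es; vm_compute (fib _ ^ _); lia.
  have e : \prod_(i <- s) fib i = 3 by move: es; vm_compute (fib _ ^ _); lia.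
  by rewrite (fib_prod_3 ss s3 e); left.
have e : \prod_(i <- s) fib i = 8 by move: es; vm_compute (fib _ ^ _); lia.
by have [->|->] := fib_prod_8 ss s3 e; left.
Qed.

Theorem theorem11 :
  (forall m : nat, 1 <= m ->
     exists (k : nat) (n : k.-tuple nat), is_solution m n) /\
  (forall (m k : nat) (n : k.-tuple nat),
     (is_solution m n /\ nontrivial n) <->
     ((m, tval n) \in sporadic_solutions \/
      (5 <= m /\ tval n = [:: m - eps m; m + eps m]))).
Proof.
split=> [m m1|m k n].
  (* The identity behind the infinite family already holds for every m >= 1, so it also supplies the
     existence claim. *)
  exists 2, [tuple m - eps m; m + eps m]; split=> //.
    by rewrite /= andbT; apply: leq_trans (leq_subr _ _) (leq_addr _ _).
  by rewrite !big_cons big_nil muln1; exact: fib_catalan.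
split=> [/nontrivial_solutionE|h]; first exact: nontrivial_solution_listed.
by apply/nontrivial_solutionE; exact: listed_nontrivial_solution.
Qed.
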